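(* Fix a unit $n\in[N]$ and a counterfactual treatment assignment $\tilde a\in[D]^N$, with donor set $\mathcal I=\mathcal I^{(n)}$. Suppose: (1) (SNTVA) $Y^{(a)}_{t,i}=Y^{(a_{\mathcal N(i)})}_{t,i}$ for all $t\in[T]$, $i\in[N]$, $a\in[D]^N$; (2) (network latent factor model) there are latent factors $u_{j,i},w_{t,b}\in\mathbb R^r$ such that for all $t,i,a$ $$Y^{(a_{\mathcal N(i)})}_{t,i}=\langle u_{i,i},w_{t,a_i}\rangle+\sum_{j\in\mathcal N(i)\setminus\{i\}}\langle u_{j,i},w_{t,a_j}\rangle+\epsilon^{(a_{\mathcal N(i)})}_{t,i},\qquad \mathbb E\big[\epsilon^{(a_{\mathcal N(i)})}_{t,i}\mid LF\big]=0;$$ (3) (conditional exogeneity) $Y^{(a_{\mathcal N(i)})}_{t,i}\perp A\mid LF$ for all $i,t,a$; (4) (linear span inclusion) $\mathcal I$ is non-empty and there exists $\lambda\in\mathbb R^{|\mathcal I|}$ with $\tilde u_{n,\mathcal N(n)}=\sum_{i\in\mathcal I}\lambda_i\,\tilde u_{i,\pi_i(\mathcal N(i))}$; (5) (subspace inclusion) the rowspace of $\mathbb E[Z_{\mathrm{pr},\mathcal I}\mid LF,A]$ lies within the rowspace of $\mathbb E[Z_{\mathrm{tr},\mathcal I}\mid LF,A]$. Then $$\mathrm{IPO}_n=\frac1{T_{\mathrm{pr}}}\mathbf 1_{T_{\mathrm{pr}}}^\top\;\mathbb E[Z_{\mathrm{pr},\mathcal I}\mid LF,A]\;\mathbb E[Z_{\mathrm{tr},\mathcal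 I}\mid LF,A]^+\;\mathbb E[z_{\mathrm{tr},n}\mid LF,A],$$ where $\mathbf 1_{T_{\mathrm{pr}}}$ is the all-ones vector of length $T_{\mathrm{pr}}$ and ${}^+$ denotes the pseudo-inverse. Consequently $\mathrm{IPO}_n$ is identifiable.
   Context: $[X]=\{1,\dots,X\}$. There are $N\ge1$ units, $D\ge1$ treatments, $T\ge1$ measurements. $\mathcal G=([N],\mathcal E)$ is a fixed, known undirected graph with all self-edges included; $\mathcal N(n)=\{j:(j,n)\in\mathcal E\}$ (so $n\in\mathcal N(n)$), with a fixed ordering of its elements $\mathcal N_1(n),\mathcal N_2(n),\dots$. For $a\in[D]^N$ and $S\subseteq[N]$, $a_S$ is the subvector indexed by $S$. $Y^{(a)}_{t,n}$ is the (real random) potential outcome of unit $n$ at measurement $t$ when the treatments of all units are $a$. Data: $A=[a^1,\dots,a^T]\in[D]^{N\times T}$ is the observed treatment assignment; $Z\in\mathbb R^{T\times N}$ with $Z_{t,n}=Y^{(a^t)}_{t,n}$ is observed. $\mathcal T_{\mathrm{tr}}=\{1,\dots,T_{\mathrm{tr}}\}$ (training) and $\mathcal T_{\mathrm{pr}}=\{T_{\mathrm{tr}}+1,\dots,T\}$ (prediction), $T_{\mathrm{pr}}=|\mathcal T_{\mathrm{pr}}|$. The treatment is constant on the prediction set: $a^t=a^{\mathrm{pr}}$ for $t\in\mathcal T_{\mathrm{pr}}$. $M[S_1,S_2]$ denotes a submatrix. $LF=\{u_{j,i},w_{t,b}: i,j\in[N],t\in[T],b\in[D]\}$. $\tilde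 u_{n,\mathcal N(n)}\in\mathbb R^{r|\mathcal N(n)|}$ is the concatenation of $u_{\mathcal N_1(n),n},u_{\mathcal N_2(n),n},\dots$; $\tilde u_{i,\pi_i(\mathcal N(i))}$ is the same concatenation for unit $i$ with its neighbors listed in the order given by the permutation $\pi_i$. Donor set $\mathcal I^{(n)}$ (for $n$ and $\tilde a_{\mathcal N(n)}$): the set of units $i\ne n$ such that $|\mathcal N(i)|=|\mathcal N(n)|$ and there is a permutation $\pi_i$ of $\mathcal N(i)$ with $A[\pi_i(\mathcal N(i)),\mathcal T_{\mathrm{tr}}]=A[\mathcal N(n),\mathcal T_{\mathrm{tr}}]$ and $a^{\mathrm{pr}}_{\pi_i(\mathcal N(i))}=\tilde a_{\mathcal N(n)}$; such a $\pi_i$ is fixed for each donor. $z_{\mathrm{tr},n}=Z[\mathcal T_{\mathrm{tr}},n]$, $Z_{\mathrm{tr},\mathcal I}=Z[\mathcal T_{\mathrm{tr}},\mathcal I]$, $Z_{\mathrm{pr},\mathcal I}=Z[\mathcal T_{\mathrm{pr}},\mathcal I]$. Estimand: $\mathrm{IPO}_n=\frac1{T_{\mathrm{pr}}}\sum_{t\in\mathcal T_{\mathrm{pr}}}\mathbb E\big[Y^{(\tilde a_{\mathcal N(n)})}_{t,n}\mid LF\big]$. Identifiability: with model parameter $\theta=LF$ ranging over a parameter set $\Theta$, $P_\theta$ the joint distribution of the observed outcomes $Z[\mathcal T_{\mathrm{tr}},:]$ and $Z[\mathcal T_{\mathrm{pr}},:]$ (with $A,\mathcal G,\mathcal T_{\mathrm{tr}},\mathcal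 T_{\mathrm{pr}}$ known), and $\mathcal P=\{P_{\theta'}:\theta'\in\Theta\}$, an estimand $f(\theta)$ is identifiable if there is a function $g:\mathcal P\to\mathbb R$ with $f(\theta)=g(P_\theta)$. *)

(* Defs.v *)
From HB Require Import structures.
From mathcomp Require Import all_boot all_order all_algebra all_fingroup.
From mathcomp Require Import all_classical all_reals all_analysis.

Set Implicit Arguments.
Unset Strict Implicit.
Unset Printing Implicit Defensive.

Import Order.TTheory GRing.Theory Num.Theory.
Local Open Scope classical_set_scope.
Local Open Scope ring_scope.

Section pseudo_inverse.
Context {R : realFieldType}.
Implicit Types m n : nat.

Definition moore_penrose m n (A : 'M[R]_(m, n)) (X : 'M[R]_(n, m)) : Prop :=
  [/\ A *m X *m A = A, X *m A *m X = X,
      (A *m X)^T = A *m X & (X *m A)^T = X *m A].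

Definition mpinv m n (A : 'M[R]_(m, n)) : 'M[R]_(n, m) :=
  xget 0 [set X | moore_penrose A X].

Lemma moore_penrose_uniq m n (A : 'M[R]_(m, n)) X Y :
  moore_penrose A X -> moore_penrose A Y -> X = Y.
Proof.
move=> [x1 x2 x3 x4] [y1 y2 y3 y4].
have AXY : A *m X = A *m Y.
  have E : A *m X *m (A *m Y) = A *m Y by rewrite mulmxA x1.
  have E' : A *m Y *m (A *m X) = A *m X by rewrite mulmxA y1.
  by rewrite -E' -y3 -x3 -trmx_mul E y3.
have XYA : X *m A = Y *m A.
  have E : X *m A *m (Y *m A) = X *m A by rewrite -mulmxA (mulmxA A) y1.
  have E' : Y *m A *m (X *m A) = Y *m A by rewrite -mulmxA (mulmxA A) x1.
  by rewrite -E -y4 -x4 -trmx_mul E' y4.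
by rewrite -x2 XYA -mulmxA AXY mulmxA y2.
Qed.

Lemma gram_unit m n (F : 'M[R]_(m, n)) : row_free F -> F *m F^T \in unitmx.
Proof.
move=> Ff; rewrite -row_free_unit; apply/row_freeP.
have : row_free (F *m F^T).
  rewrite -kermx_eq0 -submx0; apply/rV_subP => v /sub_kermxP vK.
  have /eqP : \sum_j (v *m F) 0 j ^+ 2 = 0.
    have vFF : (v *m F) *m (v *m F)^T = 0.
      by rewrite trmx_mul mulmxA -(mulmxA v) vK mul0mx.
    have := congr1 (fun M : 'M[R]_(1, 1) => M 0 0) vFF.
    rewrite mxE [RHS]mxE => sum0; rewrite -[RHS]sum0.
    by apply: eq_bigr => j _; rewrite [X in _ * X]mxE expr2.
  rewrite psumr_eq0; last by move=> j _; exact: sqr_ge0.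
  move=> /allP v0.
  have vF0 : v *m F = 0.
    apply/rowP => j; rewrite [RHS]mxE; apply/eqP; rewrite -sqrf_eq0.
    by apply: (implyP (v0 j _)); rewrite ?mem_index_enum.
  apply/eqP; move: Ff => /row_freeP[G FG].
  suff -> : v = 0 by apply/eqP; rewrite sub0mx.
  by rewrite -(mulmx1 v) -FG mulmxA vF0 mul0mx.
by move/row_freeP.
Qed.

Lemma moore_penrose_mpinv m n (A : 'M[R]_(m, n)) : moore_penrose A (mpinv A).
Proof.
apply: xgetPex.
have [k [C [F [CF fC fF]]]] : exists k (C : 'M[R]_(m, k)) (F : 'M[R]_(k, n)),
    [/\ C *m F = A, row_full C & row_free F].
  exists (\rank A), (col_base A), (row_base A).
  by rewrite mulmx_base row_base_free col_base_full.
have uF : F *m F^T \in unitmx by exact: gram_unit.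
have uC : C^T *m C \in unitmx.
  by rewrite -[X in _ *m X]trmxK; apply: gram_unit; rewrite /row_free mxrank_tr.
set G := invmx (F *m F^T); set H := invmx (C^T *m C).
have FG : F *m F^T *m G = 1%:M by exact: mulmxV.
have HC : H *m (C^T *m C) = 1%:M by exact: mulVmx.
have tG : G^T = G by rewrite /G trmx_inv trmx_mul trmxK.
have tH : H^T = H by rewrite /H trmx_inv trmx_mul trmxK.
exists (F^T *m G *m (H *m C^T)).
have AX : A *m (F^T *m G *m (H *m C^T)) = C *m H *m C^T.
  by rewrite -CF !mulmxA -(mulmxA C) -(mulmxA C) FG mulmx1.
have XA : F^T *m G *m (H *m C^T) *m A = F^T *m G *m F.
  by rewrite -CF !mulmxA -(mulmxA _ C^T C) -(mulmxA _ H) HC mulmx1.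
split.
- by rewrite AX -{1}CF !mulmxA -(mulmxA _ C^T C) -(mulmxA _ H) HC mulmx1 CF.
- by rewrite XA !mulmxA -(mulmxA _ F F^T) -(mulmxA _ (F *m F^T)) FG mulmx1.
- by rewrite AX !trmx_mul trmxK tH mulmxA.
- by rewrite XA !trmx_mul trmxK tG mulmxA.
Qed.

End pseudo_inverse.

Section network_panel.
Context {R : realType} {d : measure_display} {Omega : measurableType d}.
Context {N D Ttr Tpr r : nat}.

(* Measurements are indexed by 'I_(Ttr + Tpr): [lshift Tpr t] is a training
   measurement and [rshift Ttr t] a prediction measurement. *)
Local Notation measurement := 'I_(Ttr + Tpr).
Local Notation treatment := {ffun 'I_N -> 'I_D}.
Local Notation assignment := 'M['I_D]_(N, Ttr + Tpr).

(* [lf_u theta j i] is u_{j,i} and [lf_w theta t b] is w_{t,b}. *)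
Record latent_factors : Type := LatentFactors {
  lf_u : 'I_N -> 'I_N -> 'rV[R]_r;
  lf_w : measurement -> 'I_D -> 'rV[R]_r }.

Definition inner (x y : 'rV[R]_r) : R := \sum_k x 0 k * y 0 k.

Definition nbhd (E : rel 'I_N) (i : 'I_N) : {set 'I_N} := [set j | E j i].

Definition is_ordering (S : {set 'I_N}) (s : seq 'I_N) : Prop :=
  uniq s /\ s =i S.

Definition subvec (S : {set 'I_N}) (a : treatment) :
  {ffun {j | j \in S} -> 'I_D} := [ffun j => a (val j)].

Definition treatment_at (A : assignment) (t : measurement) : treatment :=
  [ffun j => A j t].

(* [Y t i a] is the potential outcome of unit i at measurement t when all
   units are treated according to a; [Yn t i b] is the one indexed by a treatment
   vector b of the neighborhood of i only.
   Conditioning on the latent factors is disintegrated: a probability P on Omega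
   below is the conditional law of (Y, A) given LF = theta, so that
   E[. | LF] at LF = theta is the expectation under P, and E[. | LF, A] at
   (LF, A) = (theta, a) is the expectation under [given_assignment P] of
   the event A = a. *)
Section assumptions.
Variable E : rel 'I_N.
Variable Y : measurement -> 'I_N -> treatment -> Omega -> R.
Variable Yn : forall (t : measurement) (i : 'I_N),
  {ffun {j | j \in nbhd E i} -> 'I_D} -> Omega -> R.
Variable A : Omega -> assignment.

Definition sntva : Prop :=
  forall t i a, Y t i a = Yn t (subvec (nbhd E i) a).

Definition network_latent_factor_model (P : probability Omega R)
    (theta : latent_factors) : Prop :=
  exists eps : forall (t : measurement) (i : 'I_N),
      {ffun {j | j \in nbhd E i} -> 'I_D} -> Omega -> R,
  forall t i a,
  [/\ forall x, Yn t (subvec (nbhd E i) a) x =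
        inner (lf_u theta i i) (lf_w theta t (a i)) +
        \sum_(j in nbhd E i :\ i) inner (lf_u theta j i) (lf_w theta t (a j)) +
        eps t i (subvec (nbhd E i) a) x,
      P.-integrable setT (EFin \o eps t i (subvec (nbhd E i) a)) &
      ('E_P[eps t i (subvec (nbhd E i) a)] = 0)%E].

Definition exogeneity (P : probability Omega R) : Prop :=
  forall t i a (B : set R) (C : set assignment), measurable B ->
  P ((Yn t (subvec (nbhd E i) a) @^-1` B) `&` (A @^-1` C)) =
  (P (Yn t (subvec (nbhd E i) a) @^-1` B) * P (A @^-1` C))%E.

Definition observed (t : measurement) (i : 'I_N) (x : Omega) : R :=
  Y t i (treatment_at (A x) t) x.

(* Z[T_tr, :] and Z[T_pr, :], as elements of measurable product spaces. *)
Definition observed_panel (x : Omega) :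
    Ttr.-tuple (N.-tuple R) * Tpr.-tuple (N.-tuple R) :=
  ([tuple [tuple observed (lshift Tpr t) i x | i < N] | t < Ttr],
   [tuple [tuple observed (rshift Ttr t) i x | i < N] | t < Tpr]).

(* The conditional probability given A = a; it is only meaningful when
   that event has positive probability. *)
Definition given_assignment (P : probability Omega R) (a : assignment)
    (ma : measurable (A @^-1` [set a])) : probability Omega R :=
  mnormalize (mrestr P ma) P.

Definition mean_observed (P : probability Omega R) : 'M[R]_(Ttr + Tpr, N) :=
  \matrix_(t, i) fine 'E_P[observed t i]%E.

(* The law of the observed panel. A measure of the library is a total function
   on sets whose values at non-measurable sets carry no meaning, hence
   the restriction to the sigma-algebra. *)
Definition observed_law (P : probability Omega R) :
    {B : set (Ttr.-tuple (N.-tuple R) * Tpr.-tuple (N.-tuple R)) |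
      measurable B} -> \bar R :=
  fun B => P (observed_panel @^-1` (sval B)).

Definition ipo (P : probability Omega R) (n : 'I_N) (atilde : treatment) : R :=
  Tpr%:R^-1 *
  \sum_(t < Tpr) fine 'E_P[Yn (rshift Ttr t) (subvec (nbhd E n) atilde)]%E.

End assumptions.

Section donors.
Variable E : rel 'I_N.
Variable nord : 'I_N -> seq 'I_N.

(* The neighbors of i, listed in the order given by the permutation p. *)
Definition permuted_nbrs (p : {perm 'I_N}) (i : 'I_N) : seq 'I_N :=
  [seq p j | j <- nord i].

Definition donor_matching (Aobs : assignment) (apr atilde : treatment)
    (n i : 'I_N) (p : {perm 'I_N}) : bool :=
  [&& perm_on (nbhd E i) p,
      [forall t : 'I_Ttr,
        [seq Aobs j (lshift Tpr t) | j <- permuted_nbrs p i] ==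
        [seq Aobs j (lshift Tpr t) | j <- nord n]] &
      [seq apr j | j <- permuted_nbrs p i] == [seq atilde j | j <- nord n]].

Definition donor_set (Aobs : assignment) (apr atilde : treatment) (n : 'I_N) :
    {set 'I_N} :=
  [set i | [&& i != n, #|nbhd E i| == #|nbhd E n| &
    [exists p, donor_matching Aobs apr atilde n i p]]].

(* The concatenation of u_{s_1,i}, ..., u_{s_m,i}; to be used with
   m = size s, so that the default value of nth plays no role. *)
Definition concat_u (theta : latent_factors) (m : nat) (s : seq 'I_N)
    (i : 'I_N) : 'rV[R]_(m * r) :=
  mxvec (\matrix_(k < m) lf_u theta (nth i s k) i).

Definition linear_span_inclusion (theta : latent_factors) (n : 'I_N)
    (I : {set 'I_N}) (pi : 'I_N -> {perm 'I_N}) : Prop :=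
  I != finset.set0 /\
  exists lambda : 'rV[R]_#|I|,
    concat_u theta #|nbhd E n| (nord n) n =
    \sum_(k < #|I|) lambda 0 k *:
      concat_u theta #|nbhd E n|
        (permuted_nbrs (pi (enum_val k)) (enum_val k)) (enum_val k).

End donors.

Definition columns (T : nat) (I : {set 'I_N}) (M : 'M[R]_(T, N)) :
    'M[R]_(T, #|I|) :=
  colsub (fun k : 'I_#|I| => enum_val k) M.

End network_panel.

Arguments latent_factors : clear implicits.

(* Only the values of g on the laws of the model matter. *)
Definition identifiable (R : realType) (Param Law : Type) (Theta : set Param)
    (law : Param -> Law) (f : Param -> R) : Prop :=
  exists g : Law -> R, forall theta, Theta theta -> f theta = g (law theta).

(* Main.v *)
(** Exogeneity makes the law of an observed outcome given the assignment the law
    of the potential outcome, so its mean is bilinear in the latent factors.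
    A donor has seen the treatments of the target unit, up to a permutation of
    neighbors; the span relation with coefficients [lambda] therefore gives
    [EZtr_n = EZtr_I lambda] and [IPO = (1/Tpr) 1^T EZpr_I lambda]. Writing
    [EZpr_I = C EZtr_I], one gets
    [EZpr_I EZtr_I^+ EZtr_I lambda = EZpr_I lambda]
    from [M M^+ M = M]. The formula only involves means of the observed panel,
    which its law determines. *)
Require Import Defs.
From HB Require Import structures.
From mathcomp Require Import all_boot all_order all_algebra all_fingroup.
From mathcomp Require Import all_classical all_reals all_analysis.
From mathcomp Require Import measurable_realfun.

Set Implicit Arguments.
Unset Strict Implicit.
Unset Printing Implicit Defensive.

Import Order.TTheory GRing.Theory Num.Theory.
Local Open Scope classical_set_scope.
Local Open Scope ring_scope.

(** * Linear algebra and orderings of a neighborhood *)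

Lemma mulmx_mpinv_sub (R : realFieldType) m1 m2 k (A : 'M[R]_(m1, k))
    (B : 'M[R]_(m2, k)) : (B <= A)%MS -> B *m mpinv A *m A = B.
Proof.
case/submxP=> C ->; have [AXA _ _ _] := moore_penrose_mpinv A.
by rewrite -!mulmxA (mulmxA A) AXA.
Qed.

Lemma inner_suml (R : realType) (I : Type) (s : seq I) q
    (c : I -> R) (v : I -> 'rV[R]_q) (y : 'rV[R]_q) :
  inner (\sum_(i <- s) c i *: v i) y = \sum_(i <- s) c i * inner (v i) y.
Proof.
rewrite /inner; under eq_bigr do rewrite summxE mulr_suml.
rewrite exchange_big; apply: eq_bigr => i _; rewrite mulr_sumr.
by apply: eq_bigr => j _; rewrite mxE mulrA.
Qed.

Lemma inner_mxvec (R : realType) m q (A B : 'M[R]_(m, q)) :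
  inner (mxvec A) (mxvec B) = \sum_i inner (row i A) (row i B).
Proof.
rewrite /inner pair_bigA /= (reindex _ (curry_mxvec_bij _ _)) /=.
by apply: eq_bigr => -[i j] _; rewrite !mxvecE !mxE.
Qed.

Lemma is_ordering_perm N (S : {set 'I_N}) s (p : {perm 'I_N}) :
  perm_on S p -> is_ordering S s -> is_ordering S [seq p j | j <- s].
Proof.
move=> pS [us sS]; split; first by rewrite (map_inj_uniq perm_inj).
move=> j; apply/mapP/idP => [[k + ->]|jS]; first by rewrite sS perm_closed.
exists (p^-1%g j); last by rewrite permKV.
by rewrite sS -(perm_closed _ pS) permKV.
Qed.

Lemma size_is_ordering N (S : {set 'I_N}) s : is_ordering S s -> size s = #|S|.
Proof. by case=> us sS; rewrite -(eq_card sS) (card_uniqP us). Qed.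

(** * Laws, conditioning on the assignment, and identifiability *)

Lemma expectation_eq_law (R : realType) d1 d2 (T1 : measurableType d1)
    (T2 : measurableType d2) (P1 : probability T1 R) (P2 : probability T2 R)
    (X1 : T1 -> R) (X2 : T2 -> R) :
  measurable_fun setT X1 -> measurable_fun setT X2 ->
  (forall S, measurable S -> P1 (X1 @^-1` S) = P2 (X2 @^-1` S)) ->
  ('E_P1[X1] = 'E_P2[X2])%E.
Proof.
move=> mX1 mX2 lawE.
(* Change of variables to the pushforward measure. It is applied to the positive and negative parts
   of [EFin], whose compositions with [X1] and [X2] are the parts in the two expectations. *)
have ge0_eq (f : R -> \bar R) : measurable_fun setT f ->
    (forall y, 0 <= f y)%E ->
    (\int[P1]_x (f \o X1) x = \int[P2]_x (f \o X2) x)%E.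
  move=> mf f0.
  have := ge0_integral_pushforward mX1 P1 measurableT mf.
  rewrite preimage_setT => <-; last by move=> y _; exact: f0.
  have := ge0_integral_pushforward mX2 P2 measurableT mf.
  rewrite preimage_setT => <-; last by move=> y _; exact: f0.
  by apply: eq_measure_integral => S mS _; exact: lawE.
have mE : measurable_fun setT (@EFin R) by exact/measurable_EFinP.
rewrite unlock integralE [RHS]integralE; congr (_ - _)%E.
- have := ge0_eq _ (measurable_funepos mE) (@funepos_ge0 _ _ _).
  by rewrite unlock.
- have := ge0_eq _ (measurable_funeneg mE) (@funeneg_ge0 _ _ _).
  by rewrite unlock.
Qed.

(** [mnormalize] has a fallback for zero or infinite mass; positivity of the event and the bound of
    a probability by 1 exclude both cases. *)
Lemma given_assignmentE (R : realType) d (Omega : measurableType d)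
    (N D Ttr Tpr : nat) (A : Omega -> 'M['I_D]_(N, Ttr + Tpr))
    (P : probability Omega R) a (ma : measurable (A @^-1` [set a])) S :
  (0 < P (A @^-1` [set a]))%E ->
  given_assignment P ma S =
    (P (S `&` A @^-1` [set a]) * (fine (P (A @^-1` [set a])))^-1%:E)%E.
Proof.
move=> Pa; rewrite /given_assignment /= /mnormalize /= /mrestr setTI.
by rewrite gt_eqF //= lt_eqF // (le_lt_trans (probability_le1 _ _)) ?ltry //; exact: ma.
Qed.

Lemma identifiable_law (R : realType) (Param Law : Type) (Theta : set Param)
    (law : Param -> Law) (f : Param -> R) :
  (forall theta theta', Theta theta -> Theta theta' ->
     law theta = law theta' -> f theta = f theta') ->
  identifiable Theta law f.
Proof.
move=> finj.
(* [g] chooses a parameter of the model with law [L]; off the model it takes the default 0. *)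
exists (fun L => if pselect (exists2 theta, Theta theta & law theta = L) is
                 left ex then f (s2val (cid2 ex)) else 0).
move=> theta Ttheta; case: pselect => [ex|[]]; last by exists theta.
by case: cid2 => theta' T' lawE /=; exact: finj.
Qed.

(** * Latent and observed means in the network panel *)

Section network_panel.
Context (R : realType) (d : measure_display) (Omega : measurableType d).
Context (N D Ttr Tpr r : nat).
Variable E : rel 'I_N.
Hypothesis E_refl : reflexive E.
Variable Y : 'I_(Ttr + Tpr) -> 'I_N -> {ffun 'I_N -> 'I_D} -> Omega -> R.
Variable Yn : forall (t : 'I_(Ttr + Tpr)) (i : 'I_N),
  {ffun {j | j \in nbhd E i} -> 'I_D} -> Omega -> R.
Hypothesis mY : forall t i a, measurable_fun setT (Y t i a).
Hypothesis mYn : forall t i b, measurable_fun setT (@Yn t i b).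
Variable A : Omega -> 'M['I_D]_(N, Ttr + Tpr).
Hypothesis mA : forall a, measurable (A @^-1` [set a]).
Implicit Types (P : probability Omega R) (theta : latent_factors R N D Ttr Tpr r).

(** The unit's own term is merged with those of its neighbors, as self-edges put [i] in [nbhd E i];
    this matches the blocks of [concat_u]. *)
Definition latent_mean theta t i (a : {ffun 'I_N -> 'I_D}) : R :=
  \sum_(j in nbhd E i) inner (lf_u theta j i) (lf_w theta t (a j)).

Lemma expectation_potential_outcome P theta t i a :
  network_latent_factor_model Yn P theta ->
  ('E_P[Yn t (subvec (nbhd E i) a)] = (latent_mean theta t i a)%:E)%E.
Proof.
case=> eps /(_ t i a) [YE ieps Eeps].
have -> : Yn t (subvec (nbhd E i) a) =
    fun x => latent_mean theta t i a + eps t i (subvec (nbhd E i) a) x.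
  have iE : i \in nbhd E i by rewrite finset.in_set; exact: E_refl.
  by apply/funext => x; rewrite YE /latent_mean (big_setD1 i iE).
move: Eeps; rewrite unlock => Eeps.
under eq_integral do rewrite EFinD.
rewrite integralD //=; last exact: finite_measure_integrable_cst.
by rewrite Eeps adde0 integral_cst //= probability_setT mule1.
Qed.

(** The index of the potential outcome is random, but takes finitely many values: on each event
    [A = a] a fixed measurable [Y t i] is observed. *)
Lemma measurable_observed t i : measurable_fun setT (observed Y A t i).
Proof.
move=> _ S mS; rewrite setTI.
have -> : observed Y A t i @^-1` S = \bigcup_a
    (A @^-1` [set a] `&` Y t i (treatment_at a t) @^-1` S).
  apply/seteqP; split=> x /=; first by exists (A x).
  by case=> a _ [/= <-].
apply: fin_bigcup_measurable; first exact: finite_finset.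
move=> a _; apply: measurableI; first exact: mA.
by rewrite -[X in measurable X]setTI; exact: mY.
Qed.

(** On the event [A = a] the observed outcome is the potential one. Exogeneity factors the joint
    probability, and normalization cancels the factor of the event. *)
Lemma expectation_observed P a (ma : measurable (A @^-1` [set a])) t i :
  sntva Y Yn -> exogeneity Yn A P -> (0 < P (A @^-1` [set a]))%E ->
  ('E_(given_assignment P ma)[observed Y A t i] =
   'E_P[Yn t (subvec (nbhd E i) (treatment_at a t))])%E.
Proof.
move=> YE exo Pa; apply: expectation_eq_law => //.
  exact: measurable_observed.
move=> S mS; rewrite given_assignmentE //.
have -> : observed Y A t i @^-1` S `&` A @^-1` [set a] =
    Yn t (subvec (nbhd E i) (treatment_at a t)) @^-1` S `&` A @^-1` [set a].
  by apply/seteqP; split=> x [/= xS Ax]; split=> //=;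
    move: xS; rewrite /observed Ax YE.
rewrite exo // -muleA -[X in (_ * (X * _))%E]fineK ?fin_num_measure //.
by rewrite -EFinM divff ?mule1 // fine_eq0 ?fin_num_measure // gt_eqF.
Qed.

Lemma mean_observed_law P P' :
  observed_law Y A P = observed_law Y A P' ->
  mean_observed Y A P = mean_observed Y A P'.
Proof.
move=> lawE; apply/matrixP => t i; rewrite !mxE; congr fine.
apply: expectation_eq_law; [exact: measurable_observed..|].
move=> S mS.
(* The entry at [t], [i] is a measurable coordinate of the panel, so the panel law determines its
   law. *)
pose proj (z : Ttr.-tuple (N.-tuple R) * Tpr.-tuple (N.-tuple R)) : R :=
  match fintype.split t with
  | inl t1 => tnth (tnth z.1 t1) i
  | inr t2 => tnth (tnth z.2 t2) i
  end.
have mproj : measurable_fun setT proj.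
  rewrite /proj; case: fintype.split => t'.
  - apply: (measurableT_comp (measurable_tnth i)).
    exact: (measurableT_comp (measurable_tnth t')).
  - apply: (measurableT_comp (measurable_tnth i)).
    exact: (measurableT_comp (measurable_tnth t')).
have mB : measurable (proj @^-1` S).
  by rewrite -[X in measurable X]setTI; exact: mproj.
have projE x : proj (observed_panel Y A x) = observed Y A t i x.
  rewrite /proj -[t in RHS]splitK; case: fintype.split => t' /=;
  by rewrite !tnth_mktuple.
have := congr1 (fun f => f (exist _ _ mB)) lawE; rewrite /observed_law /=.
suff -> : observed_panel Y A @^-1` (proj @^-1` S) = observed Y A t i @^-1` S by [].
by apply/seteqP; split=> x /=; rewrite projE.
Qed.

(** The second factor depends only on the list of treatments, so it can be read off along another
    unit's list [s']. This gives a donor and the target unit a common second factor. [i'] is a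
    default for [nth]; the equal treatment lists have equal lengths, which keeps indices in
    range. *)
Lemma latent_mean_concat theta t m (s s' : seq 'I_N) i i'
    (a a' : {ffun 'I_N -> 'I_D}) :
  is_ordering (nbhd E i) s -> size s = m ->
  [seq a j | j <- s] = [seq a' j | j <- s'] ->
  latent_mean theta t i a =
    inner (concat_u theta m s i)
      (mxvec (\matrix_(k < m) lf_w theta t (a' (nth i' s' k)))).
Proof.
move=> [us sS] <- aE.
rewrite /latent_mean /concat_u inner_mxvec -(eq_bigl _ _ sS) -big_uniq //=.
rewrite (big_nth i) big_mkord; apply: eq_bigr => k _; rewrite !rowK.
congr (inner _ (lf_w _ _ _)).
have := congr1 (fun z => nth (a i) z k) aE.
rewrite (nth_map i) // => ->; apply: nth_map.
by have /(congr1 size) := aE; rewrite !size_map => <-.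
Qed.

End network_panel.

Theorem theorem1 (R : realType) (d : measure_display) (Omega : measurableType d)
  (N D Ttr Tpr r : nat) (Tpr_gt0 : (0 < Tpr)%N)
  (E : rel 'I_N) (E_sym : symmetric E) (E_refl : reflexive E)
  (nord : 'I_N -> seq 'I_N)
  (nordP : forall i, is_ordering (nbhd E i) (nord i))
  (Y : 'I_(Ttr + Tpr) -> 'I_N -> {ffun 'I_N -> 'I_D} -> Omega -> R)
  (Yn : forall (t : 'I_(Ttr + Tpr)) (i : 'I_N),
     {ffun {j | j \in nbhd E i} -> 'I_D} -> Omega -> R)
  (mY : forall t i a, measurable_fun setT (Y t i a))
  (mYn : forall t i b, measurable_fun setT (Yn t i b))
  (A : Omega -> 'M['I_D]_(N, Ttr + Tpr))
  (mA : forall a, measurable (A @^-1` [set a]))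
  (Theta : set (latent_factors R N D Ttr Tpr r))
  (P : latent_factors R N D Ttr Tpr r -> probability Omega R)
  (Aobs : 'M['I_D]_(N, Ttr + Tpr))
  (Aobs_gt0 : forall theta, Theta theta ->
     (0 < P theta (A @^-1` [set Aobs]))%E)
  (apr : {ffun 'I_N -> 'I_D})
  (aprP : forall t : 'I_Tpr, treatment_at Aobs (rshift Ttr t) = apr)
  (n : 'I_N) (atilde : {ffun 'I_N -> 'I_D})
  (I : {set 'I_N}) (I_def : I = donor_set E nord Aobs apr atilde n)
  (pi : 'I_N -> {perm 'I_N})
  (piP : forall i, i \in I -> donor_matching E nord Aobs apr atilde n i (pi i)) :
  let Pobs theta := given_assignment (P theta) (mA Aobs) in
  let EZtr theta := usubmx (mean_observed Y A (Pobs theta)) in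
  let EZpr theta := dsubmx (mean_observed Y A (Pobs theta)) in
  let IPO theta := ipo Yn (P theta) n atilde in
  sntva Y Yn ->
  (forall theta, Theta theta ->
     network_latent_factor_model Yn (P theta) theta) ->
  (forall theta, Theta theta -> exogeneity Yn A (P theta)) ->
  (forall theta, Theta theta -> linear_span_inclusion E nord theta n I pi) ->
  (forall theta, Theta theta ->
     (columns I (EZpr theta) <= columns I (EZtr theta))%MS) ->
  (forall theta, Theta theta ->
     (IPO theta)%:M =
     Tpr%:R^-1 *: ((const_mx 1 : 'rV[R]_Tpr) *m columns I (EZpr theta) *m
        mpinv (columns I (EZtr theta)) *m col n (EZtr theta)) :> 'M[R]_1) /\
  identifiable Theta (fun theta => observed_law Y A (Pobs theta)) IPO.

Proof.
move=> Pobs EZtr EZpr IPO YE lfm exo span incl.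
have EZE theta t i : Theta theta ->
    mean_observed Y A (Pobs theta) t i =
    latent_mean E theta t i (treatment_at Aobs t).
  move=> T; rewrite mxE /Pobs (expectation_observed mY mYn mA) //.
  - by rewrite (expectation_potential_outcome E_refl _ _ _ (lfm _ T)).
  - exact: exo.
  - exact: Aobs_gt0.
have IPOE theta : Theta theta -> IPO theta =
    Tpr%:R^-1 * \sum_(t < Tpr) latent_mean E theta (rshift Ttr t) n atilde.
  move=> T; rewrite /IPO /ipo; congr (_ * _); apply: eq_bigr => t _.
  by rewrite (expectation_potential_outcome E_refl _ _ _ (lfm _ T)).
have donor_deg i : i \in I -> #|nbhd E i| = #|nbhd E n|.
  by rewrite I_def finset.in_set => /and3P[_ /eqP].
(* Used with [a] the observed treatment of [n] in training, and with
   [a = atilde] in prediction. *)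
have meanE theta (lambda : 'rV[R]_#|I|) t (a : {ffun 'I_N -> 'I_D}) : Theta theta ->
    concat_u theta #|nbhd E n| (nord n) n =
    \sum_(k < #|I|) lambda 0 k *:
      concat_u theta #|nbhd E n|
        (permuted_nbrs nord (pi (enum_val k)) (enum_val k)) (enum_val k) ->
    (forall i, i \in I ->
      [seq treatment_at Aobs t j | j <- permuted_nbrs nord (pi i) i] =
      [seq a j | j <- nord n]) ->
    latent_mean E theta t n a =
    \sum_(k < #|I|) lambda 0 k * mean_observed Y A (Pobs theta) t (enum_val k).
  move=> T ulambda donorE.
  (* The vector of factors [lf_w] read along [nord n] is now fixed, and linearity in the first
     argument transports the span relation. *)
  rewrite (latent_mean_concat theta t n (nordP n)
    (size_is_ordering (nordP n)) erefl).
  rewrite ulambda inner_suml; apply: eq_bigr => k _; congr (_ * _).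
  rewrite EZE //; have kI := enum_valP k.
  have /and3P[pS _ _] := piP _ kI.
  have ord : is_ordering (nbhd E (enum_val k))
      (permuted_nbrs nord (pi (enum_val k)) (enum_val k)).
    exact: is_ordering_perm pS (nordP _).
  apply: esym; apply: latent_mean_concat (donorE _ kI) => //.
  by rewrite (size_is_ordering ord) donor_deg.
have trE theta t i :
    EZtr theta t i = mean_observed Y A (Pobs theta) (lshift Tpr t) i.
  by rewrite mxE.
have prE theta t i :
    EZpr theta t i = mean_observed Y A (Pobs theta) (rshift Ttr t) i.
  by rewrite mxE.
have IPO_formula theta : Theta theta -> (IPO theta)%:M =
    Tpr%:R^-1 *: ((const_mx 1 : 'rV[R]_Tpr) *m columns I (EZpr theta) *m
      mpinv (columns I (EZtr theta)) *m col n (EZtr theta)) :> 'M[R]_1.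
  move=> T; have [_ [lambda ulambda]] := span _ T.
  have -> : col n (EZtr theta) = columns I (EZtr theta) *m lambda^T.
    apply/colP => t; rewrite mxE trE EZE // (meanE _ lambda) //.
      rewrite mxE; apply: eq_bigr => k _.
      by rewrite [lambda^T _ _]mxE mulrC [columns _ _ _ _]mxE trE.
    move=> i /piP/and3P[_ /forallP/(_ t)/eqP donorE _].
    rewrite (eq_map (g := fun j => Aobs j (lshift Tpr t))).
      by rewrite donorE; apply: eq_map => j; rewrite ffunE.
    by move=> j; rewrite ffunE.
  (* Reassociation isolates the prediction matrix times the pseudo-inverse times the training
     matrix, which subspace inclusion collapses to the prediction matrix. *)
  rewrite -!mulmxA (mulmxA (mpinv _)) (mulmxA (columns I (EZpr theta))).
  rewrite (mulmxA (columns I (EZpr theta))) (mulmx_mpinv_sub (incl _ T)).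
  apply/matrixP => i j; rewrite !ord1 mxE eqxx mulr1n IPOE // mxE mxE.
  congr (_ * _); apply: eq_bigr => t _; rewrite mxE mul1r (meanE _ lambda) //.
    rewrite mxE; apply: eq_bigr => k _.
    by rewrite [lambda^T _ _]mxE mulrC [columns _ _ _ _]mxE prE.
  (* Every prediction column of [Aobs] is [apr], which the donor matches with [atilde]. *)
  by move=> k /piP/and3P[_ _ /eqP]; rewrite aprP.
split=> //; apply: identifiable_law => theta theta' T T' lawE.
(* Equal laws give equal means, so the formula has the same right-hand side at [theta] and
   [theta']. *)
have EZeq := mean_observed_law mY mA lawE.
have := IPO_formula theta T; rewrite /EZtr /EZpr EZeq -IPO_formula //.
by move/matrixP/(_ 0 0); rewrite !mxE eqxx !mulr1n.
Qed.
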